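(* Let $\mathfrak{s}=\mathbb{R}e_0\ltimes_A\mathbb{R}^{11}$ be a $12$-dimensional almost abelian Lie algebra, where $$A=\begin{bmatrix}\mu I_3&0\\ V&B_2\end{bmatrix},\qquad B_2=\begin{bmatrix}K(a_1,b_1)&0\\ I_4&K(a_1,b_1)\end{bmatrix},$$ with $\mu,a_1,b_1\in\mathbb{R}$, $b_1\ge0$, and $V$ the $8\times3$ matrix with columns $J_1v_0,J_2v_0,J_3v_0$ for some $v_0\in\mathbb{R}^8$ (so $\mathfrak{s}$ admits a hypercomplex structure). Then $\mathfrak{s}$ is isomorphic to one and only one of the following Lie algebras: $\mathfrak{s}_{13}^{a}$: $-f^0\wedge(0,0,0,0\,|\,af^4-f^5,f^4+af^5,af^6+f^7,-f^6+af^7\,|\,f^4+af^8-f^9,f^5+f^8+af^9,f^6+af^{10}+f^{11},f^7-f^{10}+af^{11})$, $a\ge0$; $\mathfrak{s}_{14}^{a,b}$: $-f^0\wedge(0,f^1,f^2,f^3\,|\,af^4-bf^5,bf^4+af^5,af^6+bf^7,-bf^6+af^7\,|\,f^4+af^8-bf^9,f^5+bf^8+af^9,f^6+af^{10}+bf^{11},f^7-bf^{10}+af^{11})$, $a\in\mathbb{R}$, $b>0$; $\mathfrak{s}_{15}$: $-f^0\wedge(0,0,0,0\,|\,f^4,f^5,f^6,f^7\,|\,f^4+f^8,f^5+f^9,f^6+f^{10},f^7+f^{11})$; $\mathfrak{s}_{16}^{s}$: $-f^0\wedge(0,0,0,0\,|\,0,sf^1,sf^2,sf^3\,|\,f^4,f^5,f^6,f^7)$,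 $s=0$ or $1$; $\mathfrak{s}_{17}^{a}$: $-f^0\wedge(0,f^1,f^2,f^3\,|\,af^4,af^5,af^6,af^7\,|\,f^4+af^8,f^5+af^9,f^6+af^{10},f^7+af^{11})$, $a\in\mathbb{R}$; $\mathfrak{s}_{18}$: $-f^0\wedge(0,f^1,f^2,f^3\,|\,f^4,f^1+f^5,f^2+f^6,f^3+f^7\,|\,f^4+f^8,f^5+f^9,f^6+f^{10},f^7+f^{11})$.
   Context: $\mathbb{R}e_0\ltimes_A\mathbb{R}^{11}$ is the Lie algebra with $\mathbb{R}^{11}$ an abelian ideal and $[e_0,v]=Av$. For real $a,b$, $$K(a,b)=\begin{bmatrix}a&-b&0&0\\ b&a&0&0\\ 0&0&a&b\\ 0&0&-b&a\end{bmatrix}.$$ $\mathbb{R}^8$ has ordered basis $u_0,u_1,u_2,u_3,w_0,w_1,w_2,w_3$ and carries the hypercomplex structure given by $J_\alpha u_0=u_\alpha$, $J_\alpha w_0=w_\alpha$ ($\alpha=1,2,3$), $J_\alpha^2=-I$, $J_1J_2=-J_2J_1=J_3$; $B_2$ commutes with each $J_\alpha$. Notation for Lie algebras: $-f^0\wedge(\alpha_0,\dots,\alpha_3\,|\,\alpha_4,\dots,\alpha_7\,|\,\alpha_8,\dots,\alpha_{11})$ denotes the $12$-dimensional Lie algebra with basis $f_0,\dots,f_{11}$ and dual basis $f^0,\dots,f^{11}$ such that $df^i=-f^0\wedge\alpha_i$ for $0\le i\le11$, i.e. $[f_0,f_j]=\sum_{i}\alpha_i(f_j)f_i$ for $1\le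 j\le11$ and $[f_j,f_k]=0$ for $1\le j,k\le11$. *)

(* Defs.v *)
From HB Require Import structures.
From mathcomp Require Import all_boot all_order all_algebra.
From mathcomp Require Import reals.

Set Implicit Arguments.
Unset Strict Implicit.
Unset Printing Implicit Defensive.

Import Order.TTheory GRing.Theory Num.Theory.
Local Open Scope ring_scope.

HB.mixin Record Lmodule_isLieAlgebra (R : comNzRingType) L
    of GRing.Lmodule R L := {
  lie : L -> L -> L;
  lie_linearl : forall z, linear (lie^~ z);
  lie_linearr : forall x, linear (lie x);
  lie_alt : forall x, lie x x = 0;
  lie_jacobi : forall x y z,
    lie x (lie y z) + lie y (lie z x) + lie z (lie x y) = 0
}.

#[short(type="lieAlgType")]
HB.structure Definition LieAlgebra (R : comNzRingType) :=
  {L of GRing.Lmodule R L & Lmodule_isLieAlgebra R L}.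

Definition lie_isomorphic (R : comNzRingType) (L M : lieAlgType R) : Prop :=
  exists f : {linear L -> M},
    bijective f /\ {morph f : x y / lie x y >-> lie x y}.

(* Both brackets below have the shape [x, y] = t(x) N(y) - t(y) N(x) with
   t o N = 0; the Lie axioms are checked once in this generality. *)
Section Wedge.
Variables (R : comNzRingType) (L : lmodType R) (t : L -> R) (N : L -> L).
Hypotheses (t_lin : scalar t) (N_lin : linear N).
Hypothesis tN : forall x, t (N x) = 0.
Variable b : L -> L -> L.
Hypothesis bE : forall x y, b x y = t x *: N y - t y *: N x.

Lemma wedge_linearl z : linear (b^~ z).
Proof.
move=> a x y; rewrite !bE t_lin N_lin scalerDl scalerBr !scalerDr !scalerA.
by rewrite [t z * a]mulrC opprD addrACA.
Qed.

Lemma wedge_linearr x : linear (b x).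
Proof.
move=> a y z; rewrite !bE t_lin N_lin scalerDl scalerBr !scalerDr !scalerA.
by rewrite [t x * a]mulrC opprD addrACA.
Qed.

Lemma wedge_alt x : b x x = 0.
Proof. by rewrite bE subrr. Qed.

Lemma wedge_jacobi x y z : b x (b y z) + b y (b z x) + b z (b x y) = 0.
Proof.
have N0 : N 0 = 0 by have := N_lin (-1) 0 0; rewrite !scaleN1r !addNr.
have t0 : t 0 = 0 by rewrite -N0 tN.
have bb u v w : b u (b v w) =
    (t u * t v) *: N (N w) - (t u * t w) *: N (N v).
  have tb : t (b v w) = 0.
    rewrite bE -scaleNr t_lin tN mulr0 add0r.
    by have := t_lin (- t w) (N v) 0; rewrite addr0 tN mulr0 t0 addr0.
  rewrite [LHS]bE tb scale0r subr0 bE -scaleNr N_lin.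
  have NZ c s : N (c *: s) = c *: N s by rewrite -[c *: s]addr0 N_lin N0 addr0.
  by rewrite NZ scalerDr !scalerA mulrN scaleNr.
rewrite !bb [t y * t x]mulrC [t z * t x]mulrC [t z * t y]mulrC.
by rewrite [X in X + _]addrC !subrKA subrr.
Qed.

End Wedge.

(* R e_0 |x_A R^n, where (s, v) stands for s e_0 + v. *)
Definition almost_abelian (R : comNzRingType) (n : nat) (A : 'M[R]_n) : Type :=
  (R^o * 'cV[R]_n)%type.

Section AlmostAbelian.
Variables (R : comNzRingType) (n : nat) (A : 'M[R]_n).

HB.instance Definition _ := GRing.Lmodule.copy (almost_abelian A)
  (R^o * 'cV[R]_n)%type.

Definition almost_abelian_lie (x y : almost_abelian A) : almost_abelian A :=
  (0, (x.1 : R) *: (A *m y.2) - (y.1 : R) *: (A *m x.2)).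

Let t (x : almost_abelian A) : R := x.1.
Let N (x : almost_abelian A) : almost_abelian A := (0, A *m x.2).

Let t_lin : scalar t. Proof. by []. Qed.

Let N_lin : linear N.
Proof.
move=> a x y; congr pair; first by rewrite /= scaler0 addr0.
by rewrite /= mulmxDr scalemxAr.
Qed.

Let tN x : t (N x) = 0. Proof. by []. Qed.

Let bE x y : almost_abelian_lie x y = t x *: N y - t y *: N x.
Proof. by congr pair; rewrite /= !scaler0 subr0. Qed.

HB.instance Definition _ :=
  Lmodule_isLieAlgebra.Build R (almost_abelian A)
    (wedge_linearl t_lin N_lin bE) (wedge_linearr t_lin N_lin bE)
    (wedge_alt bE) (wedge_jacobi t_lin N_lin tN bE).

End AlmostAbelian.

(* The 12-dimensional algebra -f^0 /\ (alpha_0, ..., alpha_11).  A vector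
   x : 'cV_12 has coordinates f^i(x) = x i 0, a linear form is a row vector, and
   d f^i (x, y) = - f^i([x, y]), so that
   [x, y]_i = (f^0 /\ alpha_i)(x, y) = f^0(x) alpha_i(y) - f^0(y) alpha_i(x).
   The hypothesis alpha_0 = 0, true of every list considered, gives Jacobi. *)
Definition coframe_matrix (R : comNzRingType) (alpha : seq 'rV[R]_12) :
    'M[R]_12 :=
  \matrix_(i < 12) nth 0 alpha i.

Definition coframe_alg (R : comNzRingType) (alpha : seq 'rV[R]_12)
    (alpha0 : nth 0 alpha 0 = 0) : Type :=
  'cV[R]_12.

Section Coframe.
Variables (R : comNzRingType) (alpha : seq 'rV[R]_12).
Hypothesis alpha0 : nth 0 alpha 0 = 0.

Local Notation L := (coframe_alg alpha0).

HB.instance Definition _ := GRing.Lmodule.copy L 'cV[R]_12.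

Definition coframe_lie (x y : L) : L :=
  x ord0 ord0 *: (coframe_matrix alpha *m y)
  - y ord0 ord0 *: (coframe_matrix alpha *m x).

Let t (x : L) : R := (x : 'cV[R]_12) ord0 ord0.
Let N (x : L) : L := coframe_matrix alpha *m x.

Let t_lin : scalar t. Proof. by move=> a x y; rewrite /t !mxE. Qed.

Let N_lin : linear N.
Proof. by move=> a x y; rewrite /N mulmxDr scalemxAr. Qed.

Let tN x : t (N x) = 0.
Proof. by rewrite /t /N mxE big1 // => j _; rewrite mxE alpha0 mxE mul0r. Qed.

Let bE x y : coframe_lie x y = t x *: N y - t y *: N x.
Proof. by []. Qed.

HB.instance Definition _ :=
  Lmodule_isLieAlgebra.Build R L
    (wedge_linearl t_lin N_lin bE) (wedge_linearr t_lin N_lin bE)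
    (wedge_alt bE) (wedge_jacobi t_lin N_lin tN bE).

End Coframe.

Section Families.
Variable R : realType.

Inductive label : Type :=
  | S13 of R
  | S14 of R & R
  | S15
  | S16 of R
  | S17 of R
  | S18.

Definition admissible (l : label) : Prop :=
  match l with
  | S13 a => 0 <= a
  | S14 a b => 0 < b
  | S15 => True
  | S16 s => s = 0 \/ s = 1
  | S17 a => True
  | S18 => True
  end.

Definition dual_f (i : nat) : 'rV[R]_12 := delta_mx 0 (inord i).
Local Notation f := dual_f.

Definition forms (l : label) : seq 'rV[R]_12 :=
  match l with
  | S13 a =>
      [:: 0; 0; 0; 0;
          a *: f 4 - f 5; f 4 + a *: f 5;
          a *: f 6 + f 7; - f 6 + a *: f 7;
          f 4 + a *: f 8 - f 9; f 5 + f 8 + a *: f 9;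
          f 6 + a *: f 10 + f 11; f 7 - f 10 + a *: f 11]
  | S14 a b =>
      [:: 0; f 1; f 2; f 3;
          a *: f 4 - b *: f 5; b *: f 4 + a *: f 5;
          a *: f 6 + b *: f 7; - b *: f 6 + a *: f 7;
          f 4 + a *: f 8 - b *: f 9; f 5 + b *: f 8 + a *: f 9;
          f 6 + a *: f 10 + b *: f 11; f 7 - b *: f 10 + a *: f 11]
  | S15 =>
      [:: 0; 0; 0; 0;
          f 4; f 5; f 6; f 7;
          f 4 + f 8; f 5 + f 9; f 6 + f 10; f 7 + f 11]
  | S16 s =>
      [:: 0; 0; 0; 0;
          0; s *: f 1; s *: f 2; s *: f 3;
          f 4; f 5; f 6; f 7]
  | S17 a =>
      [:: 0; f 1; f 2; f 3;
          a *: f 4; a *: f 5; a *: f 6; a *: f 7;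
          f 4 + a *: f 8; f 5 + a *: f 9; f 6 + a *: f 10; f 7 + a *: f 11]
  | S18 =>
      [:: 0; f 1; f 2; f 3;
          f 4; f 1 + f 5; f 2 + f 6; f 3 + f 7;
          f 4 + f 8; f 5 + f 9; f 6 + f 10; f 7 + f 11]
  end.

Lemma forms0 (l : label) : nth 0 (forms l) 0 = 0.
Proof. by case: l. Qed.

Definition listed_alg (l : label) : lieAlgType R := coframe_alg (forms0 l).

Definition Kmx (a b : R) : 'M[R]_4 :=
  \matrix_(i < 4, j < 4)
    nth 0 (nth [::]
      [:: [:: a; - b;   0; 0];
          [:: b;   a;   0; 0];
          [:: 0;   0;   a; b];
          [:: 0;   0; - b; a]] i) j.

Definition B2mx (a b : R) : 'M[R]_8 :=
  block_mx (Kmx a b) (0 : 'M[R]_(4, 4)) (1%:M : 'M[R]_(4, 4)) (Kmx a b).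

(* The ordered basis u_0, ..., u_3, w_0, ..., w_3 of R^8. *)
Definition basis_u (i : nat) : 'cV[R]_8 := delta_mx (inord i) 0.
Definition basis_w (i : nat) : 'cV[R]_8 := delta_mx (inord (4 + i)) 0.

Local Notation u := basis_u.
Local Notation w := basis_w.

(* These relations determine J1, J2, J3: they are left multiplication by the
   quaternions i, j, k on both copies of H. *)
Definition hypercomplex_on_basis (J1 J2 J3 : 'M[R]_8) : Prop :=
  [/\ [/\ J1 *m u 0 = u 1, J2 *m u 0 = u 2 & J3 *m u 0 = u 3],
      [/\ J1 *m w 0 = w 1, J2 *m w 0 = w 2 & J3 *m w 0 = w 3],
      [/\ J1 *m J1 = - 1%:M, J2 *m J2 = - 1%:M & J3 *m J3 = - 1%:M] &
      J1 *m J2 = J3 /\ - (J2 *m J1) = J3].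

Definition Vmx (J1 J2 J3 : 'M[R]_8) (v0 : 'cV[R]_8) : 'M[R]_(8, 3) :=
  row_mx (row_mx (J1 *m v0) (J2 *m v0)) (J3 *m v0).

Definition Amx (mu a b : R) (J1 J2 J3 : 'M[R]_8) (v0 : 'cV[R]_8) : 'M[R]_11 :=
  block_mx (mu%:M : 'M[R]_3) (0 : 'M[R]_(3, 8)) (Vmx J1 J2 J3 v0) (B2mx a b).

End Families.

(* Main.v *)
(* Identify R^3 + R^8 with Im H + H + H.  Then J_1, J_2, J_3 are left
   multiplications by i, j, k, K(a, b) is right multiplication by c = a + b i, and
     A (x, y, z) = (mu x, x p + y c, x q + y + z c)  where v_0 = (p, q).
   Almost abelian algebras whose matrices have rank > 1 are isomorphic iff their
   matrices are conjugate up to a nonzero factor.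
   If mu <> c then V is removed by a shear (x, y, z) |-> (x, y + x r, z + x s);
   if mu = c the same shear removes q, and a right multiplication by a quaternion
   turns p <> 0 into 1.  A right multiplication by j replaces c by its conjugate,
   so rescaling e_0 normalizes (mu, c).
   Conversely det (x - A) = (x - mu)^3 ((x - a)^2 + b^2)^4 determines mu, a, b^2,
   and for mu = c the condition (A - mu)^2 = 0 detects p = 0. *)
Require Import Defs.
From HB Require Import structures.
From mathcomp Require Import all_boot all_order all_algebra.
From mathcomp Require Import reals.
From mathcomp Require Import ring lra.
Import Order.TTheory GRing.Theory Num.Theory.
Local Open Scope ring_scope.

(** * Isomorphisms of almost abelian algebras *)

Lemma lie_isomorphic_intro {R : comNzRingType} {L M : lieAlgType R} (f : L -> M)
    (g : M -> L) :
  linear f -> cancel f g -> cancel g f ->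
  {morph f : x y / lie x y >-> lie x y} -> lie_isomorphic L M.
Proof.
move=> lf fK gK fM.
exists (HB.pack_for {linear L -> M} f (GRing.isLinear.Build R L M _ f lf)).
by split=> //; exists g.
Qed.

Lemma lie_isomorphic_sym {R : comNzRingType} {L M : lieAlgType R} :
  lie_isomorphic L M -> lie_isomorphic M L.
Proof.
case=> f [[g fK gK] fM]; apply: (@lie_isomorphic_intro _ _ _ g f) => //.
- exact: can2_linear fK gK.
- by move=> x y; apply: (can_inj fK); rewrite gK fM !gK.
Qed.

Lemma lie_isomorphic_trans {R : comNzRingType} {L M N : lieAlgType R} :
  lie_isomorphic L M -> lie_isomorphic M N -> lie_isomorphic L N.
Proof.
case=> f [[f' fK f'K] fM] [g [[g' gK g'K] gM]].
apply: (@lie_isomorphic_intro _ _ _ (g \o f) (f' \o g')).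
- exact: linearP.
- exact: can_comp.
- exact: can_comp.
- by move=> x y /=; rewrite fM gM.
Qed.

Lemma almost_abelian_iso (F : fieldType) n (A B P : 'M[F]_n) (k : F) :
  k != 0 -> P \in unitmx -> P *m A = k *: (B *m P) ->
  lie_isomorphic (almost_abelian A) (almost_abelian B).
Proof.
move=> k0 Pu PA.
apply: (@lie_isomorphic_intro _ _ _
  (fun x : almost_abelian A => (k * x.1, P *m x.2) : almost_abelian B)
  (fun x : almost_abelian B => (k^-1 * x.1, invmx P *m x.2) : almost_abelian A)).
- move=> a x y; congr pair; rewrite /= ?mulmxDr ?scalemxAr //.
  by rewrite mulrDr mulrCA.
- by case=> s v; rewrite /= mulKf // mulKmx.
- by case=> s v; rewrite /= mulVKf // mulKVmx.
- case=> s v [r w]; congr pair; rewrite /= ?mulr0 //.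
  by rewrite mulmxBr -!scalemxAr !mulmxA PA -!scalemxAl !scalerA -![_ * k]mulrC.
Qed.

(* In rank 1 an isomorphism need not preserve the ideal R^n (Heisenberg algebra):
   if f maps some (0, v) outside of R^n then A has rank at most 1. *)
Lemma almost_abelian_iso_inv (F : fieldType) n (A B : 'M[F]_n) :
    (1 < \rank A)%N ->
    lie_isomorphic (almost_abelian A) (almost_abelian B) ->
  exists k P, [/\ k != 0, P \in unitmx & P *m A = k *: (B *m P)].
Proof.
move=> rA [f [[g fK gK] fM]].
pose e : almost_abelian A := (1, 0); pose i v : almost_abelian A := (0, v).
have i_lin : linear i by move=> a u v; congr pair; rewrite /= scaler0 addr0.
pose t v : F := (f (i v)).1; pose p v := (f (i v)).2.
have fi_lin : linear (f \o i) by move=> a u v; rewrite /= i_lin linearP.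
have t_lin : scalar t by move=> a u v; rewrite /t [f (i _)]fi_lin.
have p_lin : linear p by move=> a u v; rewrite /p [f (i _)]fi_lin.
have bracket_e v : f (i (A *m v)) = lie (f e) (f (i v)).
  by rewrite -fM; congr (f (_, _)); rewrite /= scale1r mulmx0 scale0r subr0.
have bracket_i u v : t u *: (B *m p v) = t v *: (B *m p u).
  apply/subr0_eq; have := fM (i u) (i v).
  have -> : lie (i u) (i v) = 0 by congr pair; rewrite /= !scale0r subr0.
  by rewrite linear0 => /(congr1 snd).
have tA v : t (A *m v) = 0 by rewrite /t bracket_e.
have pA v : p (A *m v) = (f e).1 *: (B *m p v) - t v *: (B *m (f e).2).
  by rewrite /p bracket_e.
have i_inj v : t v = 0 -> p v = 0 -> v = 0.
  rewrite /t /p => tv pv; have : f (i v) = 0 by rewrite [LHS]surjective_pairing tv pv.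
  by rewrite -[X in _ = X](linear0 f) => /(can_inj fK) [].
have t0 v : t v = 0.
  apply/eqP/negPn/negP => tv.
  have tkerA w : t w = 0 -> A *m w = 0.
    move=> tw; apply: i_inj; rewrite ?tA // pA tw scale0r subr0.
    have := bracket_i v w; rewrite tw scale0r => /eqP.
    by rewrite scaler_eq0 (negPf tv) => /eqP ->; rewrite scaler0.
  suff : (\rank A <= 1)%N by rewrite leqNgt rA.
  have -> : A = (A *m v) *m (\row_j (t (delta_mx j 0) / t v)).
    apply/matrixP => a j; rewrite !mxE big_ord1 mxE.
    have := tkerA (delta_mx j 0 - (t (delta_mx j 0) / t v) *: v).
    rewrite -scaleNr addrC t_lin mulNr divfK // addNr => /(_ erefl).
    rewrite mulmxDr -scalemxAr -colE => /matrixP /(_ a 0); rewrite !mxE.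
    by move=> /eqP; rewrite mulNr addrC subr_eq0 mulrC => /eqP.
  exact: mulmx_max_rank.
pose P := \matrix_(a, j) p (delta_mx j 0) a 0.
pose pL : {linear 'cV[F]_n -> 'cV[F]_n} :=
  HB.pack_for {linear 'cV[F]_n -> 'cV[F]_n} p (GRing.isLinear.Build F _ _ _ p p_lin).
have pE v : P *m v = p v.
  have {2}-> : v = \sum_j v j 0 *: delta_mx j 0.
    by rewrite {1}[v]matrix_sum_delta; apply: eq_bigr => j _; rewrite big_ord1.
  rewrite -[p _]/(pL _) linear_sum; apply/matrixP => a b.
  rewrite ord1 mxE summxE; apply: eq_bigr => j _.
  by rewrite linearZ !mxE mulrC.
have PA : P *m A = (f e).1 *: (B *m P).
  apply/matrixP => a j.
  have entry (M : 'M_n) : M a j = (M *m delta_mx j (0 : 'I_1)) a 0.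
    by rewrite -colE mxE.
  by rewrite !entry -scalemxAl -!mulmxA !pE pA t0 scale0r subr0.
have Pu : P \in unitmx.
  rewrite -unitmx_tr -row_free_unit -kermx_eq0; apply/eqP/row_matrixP => j.
  rewrite row0; apply: trmx_inj; rewrite trmx0; apply: i_inj => //.
  rewrite -pE -[P in P *m _]trmxK -trmx_mul -row_mul mulmx_ker row0.
  exact: trmx0.
exists (f e).1, P; split=> //; apply/eqP => k0.
move: PA; rewrite k0 scale0r => /(congr1 (mulmx (invmx P))).
by rewrite mulKmx // mulmx0 => A0; rewrite A0 mxrank0 in rA.
Qed.

(** * Quaternion multiplications as matrices *)

Definition mx4 {R : pzRingType} (l : seq (seq R)) : 'M[R]_4 :=
  \matrix_(i < 4, j < 4) nth 0 (nth [::] l i) j.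

(* q |-> q (x + y i + z j + t k) on the quaternions. *)
Definition rquat_mx {R : pzRingType} (x y z t : R) : 'M[R]_4 :=
  mx4 [:: [:: x; - y; - z; - t];
          [:: y;   x;   t; - z];
          [:: z; - t;   x;   y];
          [:: t;   z; - y;   x]].

Definition lquat_i {R : pzRingType} : 'M[R]_4 :=
  mx4 [:: [:: 0; -1; 0; 0]; [:: 1; 0; 0; 0]; [:: 0; 0; 0; -1]; [:: 0; 0; 1; 0]].
Definition lquat_j {R : pzRingType} : 'M[R]_4 :=
  mx4 [:: [:: 0; 0; -1; 0]; [:: 0; 0; 0; 1]; [:: 1; 0; 0; 0]; [:: 0; -1; 0; 0]].
Definition lquat_k {R : pzRingType} : 'M[R]_4 :=
  mx4 [:: [:: 0; 0; 0; -1]; [:: 0; 0; -1; 0]; [:: 0; 1; 0; 0]; [:: 1; 0; 0; 0]].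

Ltac mx4_cases :=
  apply/matrixP => - [[|[|[|[|//]]]] ?] [[|[|[|[|//]]]] ?].
Ltac mx4_ring :=
  mx4_cases; rewrite !mxE ?big_ord_recl ?big_ord0 ?mxE /=; ring.

Lemma Kmx_rquat (R : realType) (a b : R) : Kmx a b = rquat_mx a b 0 0.
Proof. by mx4_cases; rewrite !mxE /= ?oppr0. Qed.

Lemma rquat_mulmx (R : comNzRingType) (x y z t x' y' z' t' : R) :
  rquat_mx x y z t *m rquat_mx x' y' z' t' =
  rquat_mx (x * x' - y * y' - z * z' - t * t') (x * y' + y * x' - z * t' + t * z')
           (x * z' + z * x' + y * t' - t * y') (x * t' + t * x' + z * y' - y * z').
Proof. mx4_ring. Qed.

Lemma lquat_rquat_comm (R : comNzRingType) (x y z t : R) :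
  let s := rquat_mx x y z t in
  [/\ s *m lquat_i = lquat_i *m s, s *m lquat_j = lquat_j *m s &
      s *m lquat_k = lquat_k *m s].
Proof. by split; mx4_ring. Qed.

Lemma rquat_mx_scalar (R : comNzRingType) (x : R) : rquat_mx x 0 0 0 = x%:M.
Proof. by mx4_cases; rewrite !mxE /= ?oppr0. Qed.

Lemma scale_rquat_mx (R : comNzRingType) (k x y z t : R) :
  k *: rquat_mx x y z t = rquat_mx (k * x) (k * y) (k * z) (k * t).
Proof. by mx4_cases; rewrite !mxE /= ?mulrN. Qed.

Lemma rquat_mx_unit (R : realFieldType) (x y z t : R) :
  (x != 0) || (y != 0) || (z != 0) || (t != 0) -> rquat_mx x y z t \in unitmx.
Proof.
move=> nz; set n := x ^+ 2 + y ^+ 2 + z ^+ 2 + t ^+ 2.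
have n0 : n != 0.
  apply: contraTneq nz; rewrite !negb_or !negbK => /eqP.
  rewrite /n !paddr_eq0 ?addr_ge0 ?sqr_ge0 // !sqrf_eq0.
  by move=> /andP[/andP[/andP[-> ->] ->] ->].
suff : rquat_mx x y z t *m (n^-1 *: rquat_mx x (- y) (- z) (- t)) = 1%:M.
  by case/mulmx1_unit.
rewrite -scalemxAr rquat_mulmx scale_rquat_mx -rquat_mx_scalar.
by congr rquat_mx; rewrite /n; field; rewrite -/n.
Qed.

Definition quat_basis {R : pzRingType} (i : nat) : 'cV[R]_4 := delta_mx (inord i) 0.

Lemma basis_uE {R : realType} i :
  (i < 4)%N -> basis_u R i = col_mx (quat_basis i) (0 : 'cV_4).
Proof.
move=> i4; rewrite -[RHS]delta_mx_ushift /basis_u; congr delta_mx.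
by apply: val_inj; rewrite /= !inordK // (leq_trans i4).
Qed.

Lemma basis_wE {R : realType} i :
  (i < 4)%N -> basis_w R i = col_mx (0 : 'cV_4) (quat_basis i).
Proof.
move=> i4; rewrite -[RHS]delta_mx_dshift /basis_w; congr delta_mx.
by apply: val_inj; rewrite /= !inordK // -[8%N]/(4 + 4)%N ltn_add2l.
Qed.

Lemma eq_mx_basis {R : realType} (M N : 'M[R]_8) :
  (forall i, (i < 4)%N -> M *m basis_u R i = N *m basis_u R i) ->
  (forall i, (i < 4)%N -> M *m basis_w R i = N *m basis_w R i) -> M = N.
Proof.
move=> eq_u eq_w; apply/matrixP => a j.
suff : M *m delta_mx j (0 : 'I_1) = N *m delta_mx j 0.
  by rewrite -!colE => /matrixP /(_ a 0); rewrite !mxE.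
case: (@split_ordP 4 4 j) => k ->.
  by have := eq_u k (ltn_ord k); rewrite basis_uE // /quat_basis inord_val
    -delta_mx_ushift.
by have := eq_w k (ltn_ord k); rewrite basis_wE // /quat_basis inord_val
  -delta_mx_dshift.
Qed.

Lemma lquat_basis {R : comNzRingType} :
  [/\ [/\ lquat_i *m quat_basis 0 = quat_basis 1 :> 'cV[R]_4,
          lquat_i *m quat_basis 1 = - quat_basis 0 :> 'cV[R]_4,
          lquat_i *m quat_basis 2 = quat_basis 3 :> 'cV[R]_4 &
          lquat_i *m quat_basis 3 = - quat_basis 2 :> 'cV[R]_4],
      [/\ lquat_j *m quat_basis 0 = quat_basis 2 :> 'cV[R]_4,
          lquat_j *m quat_basis 1 = - quat_basis 3 :> 'cV[R]_4,
          lquat_j *m quat_basis 2 = - quat_basis 0 :> 'cV[R]_4 &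
          lquat_j *m quat_basis 3 = quat_basis 1 :> 'cV[R]_4] &
      [/\ lquat_k *m quat_basis 0 = quat_basis 3 :> 'cV[R]_4,
          lquat_k *m quat_basis 1 = quat_basis 2 :> 'cV[R]_4,
          lquat_k *m quat_basis 2 = - quat_basis 1 :> 'cV[R]_4 &
          lquat_k *m quat_basis 3 = - quat_basis 0 :> 'cV[R]_4]].
Proof.
split; split; rewrite /quat_basis -colE; apply/matrixP => - [[|[|[|[|//]]]] ?] j;
  by rewrite !mxE -!val_eqE /= !inordK ?ord1 //= ?oppr0.
Qed.

(* Each J_a acts on x_b = J_b x_0 through the product J_a J_b. *)
Lemma quat_relations_act {R : pzRingType} {n} {J1 J2 J3 : 'M[R]_n} {x0 x1 x2 x3 : 'cV_n} :
    [/\ J1 *m J1 = - 1%:M, J2 *m J2 = - 1%:M & J3 *m J3 = - 1%:M] ->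
    J1 *m J2 = J3 /\ - (J2 *m J1) = J3 ->
    [/\ J1 *m x0 = x1, J2 *m x0 = x2 & J3 *m x0 = x3] ->
  [/\ [/\ J1 *m x1 = - x0, J1 *m x2 = x3 & J1 *m x3 = - x2],
      [/\ J2 *m x1 = - x3, J2 *m x2 = - x0 & J2 *m x3 = x1] &
      [/\ J3 *m x1 = x2, J3 *m x2 = - x1 & J3 *m x3 = - x0]].
Proof.
move=> [J11 J22 J33] [J12 J21] [<- <- <-]; rewrite !mulmxA J11 J22 J33 J12.
have -> : J1 *m J3 = - J2 by rewrite -J12 mulmxA J11 mulNmx mul1mx.
have -> : J2 *m J3 = J1.
  by rewrite -J21 mulmxN mulmxA J22 mulNmx mul1mx opprK.
have -> : J3 *m J1 = J2.
  by rewrite -J21 mulNmx -mulmxA J11 mulmxN mulmx1 opprK.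
have -> : J3 *m J2 = - J1 by rewrite -J12 -mulmxA J22 mulmxN mulmx1.
have -> : J2 *m J1 = - J3 by rewrite -J21 opprK.
by rewrite !mulNmx !mul1mx.
Qed.

Lemma diag_block_basis_u {R : realType} (L : 'M[R]_4) i : (i < 4)%N ->
  block_mx L 0 0 L *m basis_u R i = col_mx (L *m quat_basis i) (0 : 'cV_4).
Proof.
move=> i4; rewrite basis_uE // [LHS](@mul_block_col R 4 4 4 4 1).
by rewrite !mul0mx !mulmx0 !addr0.
Qed.

Lemma diag_block_basis_w {R : realType} (L : 'M[R]_4) i : (i < 4)%N ->
  block_mx L 0 0 L *m basis_w R i = col_mx (0 : 'cV_4) (L *m quat_basis i).
Proof.
move=> i4; rewrite basis_wE // [LHS](@mul_block_col R 4 4 4 4 1).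
by rewrite !mul0mx !mulmx0 !add0r.
Qed.

Lemma hypercomplex_block {R : realType} {J1 J2 J3 : 'M[R]_8} :
  hypercomplex_on_basis J1 J2 J3 ->
  [/\ J1 = block_mx lquat_i 0 0 lquat_i, J2 = block_mx lquat_j 0 0 lquat_j &
      J3 = block_mx lquat_k 0 0 lquat_k].
Proof.
case=> hu hw hsq h12; case: (hu) (hw) => [u1 u2 u3] [w1 w2 w3].
have [[u11 u12 u13] [u21 u22 u23] [u31 u32 u33]] := quat_relations_act hsq h12 hu.
have [[w11 w12 w13] [w21 w22 w23] [w31 w32 w33]] := quat_relations_act hsq h12 hw.
have [[i0 i1 i2 i3] [j0 j1 j2 j3] [k0 k1 k2 k3]] := @lquat_basis R.
have Nu i : (i < 4)%N -> col_mx (- quat_basis i) (0 : 'cV_4) = - basis_u R i.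
  by move=> i4; rewrite basis_uE // [RHS](@opp_col_mx R 4 4 1) oppr0.
have Nw i : (i < 4)%N -> col_mx (0 : 'cV_4) (- quat_basis i) = - basis_w R i.
  by move=> i4; rewrite basis_wE // [RHS](@opp_col_mx R 4 4 1) oppr0.
split; apply: eq_mx_basis => - [|[|[|[|//]]]] _.
all: first
  [ by rewrite ?(u1, u2, u3, u11, u12, u13, u21, u22, u23, u31, u32, u33)
      diag_block_basis_u // ?(i0, i1, i2, i3, j0, j1, j2, j3, k0, k1, k2, k3)
      ?Nu // ?basis_uE
  | by rewrite ?(w1, w2, w3, w11, w12, w13, w21, w22, w23, w31, w32, w33)
      diag_block_basis_w // ?(i0, i1, i2, i3, j0, j1, j2, j3, k0, k1, k2, k3)
      ?Nw // ?basis_wE ].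
Qed.

(** * The algebras with quaternionic data *)

Lemma mul_Vmx_comm {R : realType} {S J1 J2 J3 : 'M[R]_8} (v : 'cV_8) :
  [/\ S *m J1 = J1 *m S, S *m J2 = J2 *m S & S *m J3 = J3 *m S] ->
  S *m Vmx J1 J2 J3 v = Vmx J1 J2 J3 (S *m v).
Proof.
case=> S1 S2 S3; rewrite [LHS](@mul_mx_row R 8 8 (1 + 1) 1) (@mul_mx_row R 8 8 1 1).
by rewrite /Vmx !mulmxA S1 S2 S3.
Qed.

Lemma add_Vmx {R : realType} (J1 J2 J3 : 'M[R]_8) (v w : 'cV_8) :
  Vmx J1 J2 J3 v + Vmx J1 J2 J3 w = Vmx J1 J2 J3 (v + w).
Proof.
rewrite [LHS](@add_row_mx R 8 (1 + 1) 1) (@add_row_mx R 8 1 1).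
by rewrite /Vmx !mulmxDr.
Qed.

Lemma scale_Vmx {R : realType} (J1 J2 J3 : 'M[R]_8) k (v : 'cV_8) :
  k *: Vmx J1 J2 J3 v = Vmx J1 J2 J3 (k *: v).
Proof.
rewrite [LHS](@scale_row_mx R 8 (1 + 1) 1) (@scale_row_mx R 8 1 1).
by rewrite /Vmx !scalemxAr.
Qed.

Lemma Amx_iso {R : realType} {mu a b mu' a' b' : R} {J1 J2 J3 : 'M[R]_8}
    {v v' : 'cV_8} (k : R) (S : 'M_8) (r : 'cV_8) :
    let B' := B2mx a' b' in
    [/\ B' *m J1 = J1 *m B', B' *m J2 = J2 *m B' & B' *m J3 = J3 *m B'] ->
    [/\ S *m J1 = J1 *m S, S *m J2 = J2 *m S & S *m J3 = J3 *m S] ->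
    k != 0 -> S \in unitmx -> mu = k * mu' ->
    S *m B2mx a b = k *: (B' *m S) ->
    S *m v + mu *: r = k *: (v' + B' *m r) ->
  lie_isomorphic (almost_abelian (Amx mu a b J1 J2 J3 v))
                 (almost_abelian (Amx mu' a' b' J1 J2 J3 v')).
Proof.
move=> B' B'J SJ k0 Su muE SB Sv.
apply: (@almost_abelian_iso _ _ _ _ (block_mx 1%:M 0 (Vmx J1 J2 J3 r) S) _ k0).
  by rewrite unitmxE det_lblock det1 mul1r -unitmxE.
rewrite /Amx [_ *m block_mx mu%:M _ _ _]mulmx_block mulmx_block.
rewrite scale_block_mx !mul0mx !mulmx0 !mul1mx !mulmx1 !addr0 !add0r !scaler0.
rewrite scale_scalar_mx -muE SB; congr block_mx.
rewrite mul_mx_scalar (mul_Vmx_comm _ SJ) (mul_Vmx_comm _ B'J).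
by rewrite !(add_Vmx, scale_Vmx) -Sv addrC.
Qed.

Lemma Amx_rank {R : realType} (mu a b : R) (J1 J2 J3 : 'M[R]_8) (v : 'cV_8) :
  (1 < \rank (Amx mu a b J1 J2 J3 v))%N.
Proof.
suff : (4 <= \rank (Amx mu a b J1 J2 J3 v))%N by apply: ltn_trans.
pose X : 'M[R]_(4, 3 + (4 + 4)) := row_mx 0 (row_mx 0 1%:M).
pose Y : 'M[R]_(3 + (4 + 4), 4) := col_mx 0 (col_mx 1%:M 0).
have XAY : \rank (X *m Amx mu a b J1 J2 J3 v *m Y) = 4%N.
  rewrite [X *m _](@mul_row_block R 4 3 8 3 8) (@mul_row_col R 4 3 8 4).
  rewrite !mulmx0 !add0r (@mul_row_block R 4 4 4 4 4).
  rewrite (@mul_row_col R 4 4 4 4).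
  by rewrite !mul0mx !mul1mx !mulmx0 !add0r mulmx1 addr0 mxrank1.
rewrite -[X in (X <= _)%N]XAY; exact: leq_trans (mxrankM_maxl _ _) (mxrankM_maxr _ _).
Qed.

Section QuatAlg.
Context {R : realType}.
Implicit Types (mu a b k : R) (v r : 'cV[R]_8).

Definition diag2_mx (L : 'M[R]_4) : 'M[R]_8 := block_mx L 0 0 L.

Definition quat_alg mu a b v : lieAlgType R :=
  almost_abelian
    (Amx mu a b (diag2_mx lquat_i) (diag2_mx lquat_j) (diag2_mx lquat_k) v).

Lemma block_diag2_comm (L X Y Z : 'M[R]_4) :
  X *m L = L *m X -> Y *m L = L *m Y -> Z *m L = L *m Z ->
  block_mx X 0 Y Z *m diag2_mx L = diag2_mx L *m block_mx X 0 Y Z.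
Proof.
move=> XL YL ZL; rewrite [LHS](@mulmx_block R 4 4 4 4 4 4).
rewrite [RHS](@mulmx_block R 4 4 4 4 4 4).
by rewrite !mul0mx !mulmx0 !addr0 !add0r XL YL ZL.
Qed.

Lemma B2mx_comm a b : let B := B2mx a b in
  [/\ B *m diag2_mx lquat_i = diag2_mx lquat_i *m B,
      B *m diag2_mx lquat_j = diag2_mx lquat_j *m B &
      B *m diag2_mx lquat_k = diag2_mx lquat_k *m B].
Proof.
have [h1 h2 h3] := lquat_rquat_comm R a b 0 0.
by split; apply: block_diag2_comm; rewrite ?Kmx_rquat ?mulmx1 ?mul1mx.
Qed.

Lemma quat_alg_rquat mu a b a' b' v v' k x y z t :
    let S := rquat_mx x y z t in
    k != 0 -> (x != 0) || (y != 0) || (z != 0) || (t != 0) ->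
    S *m Kmx a b = k *: (Kmx a' b' *m S) ->
    col_mx (S *m usubmx (v : 'cV_(4 + 4)))
      (k *: (S *m dsubmx (v : 'cV_(4 + 4)))) = k *: v' ->
  lie_isomorphic (quat_alg (k * mu) a b v) (quat_alg mu a' b' v').
Proof.
move=> S k0 s0 SK Sv.
have [S1 S2 S3] := lquat_rquat_comm R x y z t.
apply: (Amx_iso k (block_mx S 0 0 (k *: S)) 0) => //.
- exact: B2mx_comm.
- split; apply: block_diag2_comm; rewrite ?mulmx0 ?mul0mx // -?scalemxAl -?scalemxAr.
  + by rewrite S1.
  + by rewrite S2.
  + by rewrite S3.
- have Su : S \in unitmx by exact: rquat_mx_unit.
  rewrite unitmxE (@det_lblock R 4 4) detZ unitrM unitrM unitrX ?unitfE //.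
  by rewrite -!unitfE -!unitmxE Su.
- rewrite [LHS](@mulmx_block R 4 4 4 4 4 4) [B2mx a' b' *m _](@mulmx_block R 4 4 4 4 4 4).
  rewrite !mul0mx !mulmx0 !addr0 !add0r mulmx1 mul1mx.
  rewrite [RHS](@scale_block_mx R 4 4 4 4) !scaler0 SK.
  by rewrite -scalemxAl SK -scalemxAr.
- rewrite mulmx0 addr0 scaler0 addr0 -Sv.
  rewrite -[X in _ *m X](@vsubmxK R 4 4 1) [LHS](@mul_block_col R 4 4 4 4 1).
  by rewrite !mul0mx addr0 add0r scalemxAl.
Qed.

End QuatAlg.

Lemma usubmx_basis_u0 {R : realType} :
  usubmx (basis_u R 0 : 'cV_(4 + 4)) = quat_basis 0.
Proof. by rewrite basis_uE // col_mxKu. Qed.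
Lemma dsubmx_basis_u0 {R : realType} :
  dsubmx (basis_u R 0 : 'cV_(4 + 4)) = 0.
Proof. by rewrite basis_uE // col_mxKd. Qed.

Section Reductions.
Context {R : realType}.
Implicit Types (mu a b k : R) (v r : 'cV[R]_8).

Lemma quat_alg_kill mu a b v :
  (mu != a) || (b != 0) ->
  lie_isomorphic (quat_alg mu a b v) (quat_alg mu a b 0).
Proof.
move=> ne; have Bu : B2mx (a - mu) b \in unitmx.
  rewrite unitmxE (@det_lblock R 4 4) unitrM -unitmxE andbb Kmx_rquat.
  by apply: rquat_mx_unit; rewrite subr_eq0 eq_sym -orbA ne.
have KE : Kmx a b = mu%:M + Kmx (a - mu) b.
  by rewrite !Kmx_rquat -rquat_mx_scalar; mx4_ring.
have BE : B2mx a b = mu%:M + B2mx (a - mu) b.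
  rewrite /B2mx KE (@scalar_mx_block R 4 4) [RHS](@add_block_mx R 4 4 4 4).
  by rewrite !addr0 add0r.
apply: (Amx_iso 1 1%:M (invmx (B2mx (a - mu) b) *m v)) => //.
- exact: B2mx_comm.
- by rewrite !mul1mx !mulmx1.
- exact: oner_neq0.
- exact: unitmx1.
- by rewrite mul1r.
- by rewrite mul1mx mulmx1 scale1r.
- rewrite mul1mx scale1r add0r BE mulmxDl mul_scalar_mx mulKVmx //.
  exact: addrC.
Qed.

Lemma quat_alg_kill_w mu v :
  lie_isomorphic (quat_alg mu mu 0 v)
    (quat_alg mu mu 0 (col_mx (usubmx (v : 'cV_(4 + 4))) (0 : 'cV_4))).
Proof.
apply: (Amx_iso 1 1%:M (col_mx (dsubmx (v : 'cV_(4 + 4))) (0 : 'cV_4))) => //.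
- exact: B2mx_comm.
- by rewrite !mul1mx !mulmx1.
- exact: oner_neq0.
- exact: unitmx1.
- by rewrite mul1r.
- by rewrite mul1mx mulmx1 scale1r.
- rewrite mul1mx scale1r (@mul_block_col R 4 4 4 4 1) !mul0mx !mulmx0 !addr0.
  rewrite mul1mx Kmx_rquat rquat_mx_scalar mul_scalar_mx.
  rewrite -[v in LHS](@vsubmxK R 4 4 1) [X in _ + X](@scale_col_mx R 4 4 1).
  rewrite [LHS](@add_col_mx R 4 4 1) [RHS](@add_col_mx R 4 4 1).
  by rewrite scaler0 addr0 add0r vsubmxK.
Qed.

Lemma quat_alg_scale k mu a b : k != 0 ->
  lie_isomorphic (quat_alg (k * mu) (k * a) (k * b) 0) (quat_alg mu a b 0).
Proof.
move=> k0; apply: (@quat_alg_rquat _ _ _ _ _ _ _ _ _ 1 0 0 0) => //.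
- by rewrite oner_eq0.
- by rewrite rquat_mx_scalar mul1mx mulmx1 !Kmx_rquat scale_rquat_mx !mulr0.
- by rewrite !linear0 col_mx0.
Qed.

Lemma quat_alg_conj mu a b :
  lie_isomorphic (quat_alg mu a b 0) (quat_alg mu a (- b) 0).
Proof.
rewrite -[mu in X in lie_isomorphic X _]mul1r.
apply: (@quat_alg_rquat _ _ _ _ _ _ _ _ _ 0 0 1 0); rewrite ?oner_eq0 ?orbT //.
- by rewrite scale1r !Kmx_rquat !rquat_mulmx; congr rquat_mx; ring.
- by rewrite !linear0 col_mx0.
Qed.

Lemma quat_alg_scale_abs k mu a b : k != 0 ->
  lie_isomorphic (quat_alg mu a b 0) (quat_alg (k * mu) (k * a) `|k * b| 0).
Proof.
move=> k0; apply: lie_isomorphic_sym.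
have scale : lie_isomorphic (quat_alg (k * mu) (k * a) (k * b) 0) (quat_alg mu a b 0).
  exact: quat_alg_scale.
case: (ger0P (k * b)) => _; first exact: scale.
apply: lie_isomorphic_trans scale; apply: lie_isomorphic_sym.
exact: quat_alg_conj.
Qed.

Lemma quat_alg_unit k mu a (p : 'cV[R]_4) : k != 0 -> p != 0 ->
  lie_isomorphic (quat_alg mu a 0 (col_mx p (0 : 'cV_4)))
                 (quat_alg (k * mu) (k * a) 0 (basis_u R 0)).
Proof.
move=> k0 p0; apply: lie_isomorphic_sym.
pose q (i : nat) := k * p (inord i) 0.
have qE (i : 'I_4) : q i = k * p i 0 by rewrite /q inord_val.
apply: (@quat_alg_rquat _ _ _ _ _ _ _ _ _ (q 0) (q 1) (q 2) (q 3)) => //.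
- apply: contraNT p0; rewrite !negb_or !negbK !mulf_eq0 (negPf k0) /=.
  move=> /andP[/andP[/andP[/eqP p0 /eqP p1] /eqP p2] /eqP p3].
  apply/eqP/matrixP => i j; rewrite ord1 mxE.
  by move: i => - [[|[|[|[|//]]]] h]; rewrite -[LHS]/(p (Ordinal h) 0)
    -[Ordinal h]inord_val.
- rewrite !Kmx_rquat -!/(_ *: _) !rquat_mx_scalar mul_scalar_mx mul_mx_scalar.
  by rewrite scalerA.
- rewrite usubmx_basis_u0 dsubmx_basis_u0 mulmx0 scaler0.
  rewrite [RHS](@scale_col_mx R 4 4 1) scaler0; congr col_mx.
  rewrite /quat_basis -colE; apply/matrixP => i j; rewrite ord1 !mxE.
  rewrite inordK //.
  by rewrite -qE; case: i => [[|[|[|[|//]]]] h].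
Qed.

End Reductions.

(** * The listed algebras *)

Lemma coframe_iso {F : fieldType} (A : 'M[F]_11) (alpha : seq 'rV[F]_12)
    (alpha0 : nth 0 alpha 0 = 0) :
  coframe_matrix alpha = block_mx (0 : 'M_1) 0 0 A ->
  lie_isomorphic (almost_abelian A) (coframe_alg alpha0).
Proof.
move=> aE.
apply: (@lie_isomorphic_intro _ _ _
  (fun x : almost_abelian A => col_mx x.1%:M x.2 : coframe_alg alpha0)
  (fun y : coframe_alg alpha0 =>
     ((y : 'cV_12) 0 0, dsubmx (y : 'cV_(1 + 11))) : almost_abelian A)).
- move=> c x y; rewrite /= [RHS](_ : _ = c *: col_mx x.1%:M x.2 + col_mx y.1%:M y.2) //.
  rewrite scale_col_mx add_col_mx; apply: (f_equal2 (@col_mx F 1 11 1)) => //.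
  by rewrite scale_scalar_mx -raddfD.
- case=> s v; congr pair; rewrite /= ?col_mxKd //.
  have -> : (0 : 'I_12) = lshift 11 (0 : 'I_1) by apply: val_inj.
  by rewrite (@col_mxEu _ 1 11 1) mxE.
- move=> y; rewrite /= -[RHS](@vsubmxK _ 1 11 1).
  apply: (f_equal2 (@col_mx F 1 11 1)) => //.
  apply/matrixP => i j; rewrite !ord1 !mxE /=.
  by congr (fun_of_matrix y _ _); apply: val_inj.
- case=> s v [r w]; rewrite /lie /= /coframe_lie /almost_abelian_lie /= aE.
  have e0 (t : F) (z : 'cV_11) : (col_mx (t%:M : 'M_1) z : 'cV_12) ord0 ord0 = t.
    have -> : (ord0 : 'I_12) = lshift 11 (0 : 'I_1) by apply: val_inj.
    by rewrite (@col_mxEu _ 1 11 1) mxE.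
  rewrite !e0 !(@mul_block_col _ 1 11 1 11) !mul0mx !add0r.
  rewrite !(@scale_col_mx _ 1 11 1).
  rewrite -[RHS]/(col_mx _ _ - col_mx _ _ : 'cV[F]_(1 + 11)).
  rewrite opp_col_mx add_col_mx !scaler0 subr0.
  by rewrite raddf0.
Qed.

Section Labels.
Context {R : realType}.
Implicit Types l : label R.

(* The algebra labelled l is the one with these mu, a, b and v_0 = p u_0. *)
Definition label_mu l : R := match l with S14 _ _ | S17 _ | S18 => 1 | _ => 0 end.

Definition label_a l : R :=
  match l with
  | S13 a | S14 a _ | S17 a => a | S15 | S18 => 1 | S16 _ => 0
  end.

Definition label_b l : R :=
  match l with S13 _ => 1 | S14 _ b => b | _ => 0 end.

Definition label_p l : R := match l with S16 s => s | S18 => 1 | _ => 0 end.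

Definition label_quat_alg l : lieAlgType R :=
  quat_alg (label_mu l) (label_a l) (label_b l) (label_p l *: basis_u R 0).

Local Notation f := (@dual_f R).

Definition param_forms (mu a b p : R) : seq 'rV[R]_12 :=
  [:: 0; mu *: f 1; mu *: f 2; mu *: f 3;
      a *: f 4 - b *: f 5; p *: f 1 + (b *: f 4 + a *: f 5);
      p *: f 2 + (a *: f 6 + b *: f 7); p *: f 3 + (- b *: f 6 + a *: f 7);
      f 4 + a *: f 8 - b *: f 9; f 5 + b *: f 8 + a *: f 9;
      f 6 + a *: f 10 + b *: f 11; f 7 - b *: f 10 + a *: f 11].

Lemma formsE l : forms l = param_forms (label_mu l) (label_a l) (label_b l) (label_p l).
Proof.
by case: l => *; rewrite /forms /param_forms /=
  !(scale0r, scale1r, oppr0, subr0, addr0, add0r, scaleN1r).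
Qed.

Lemma coframe_param_forms (mu a b p : R) :
  coframe_matrix (param_forms mu a b p) =
  block_mx (0 : 'M_1) 0 0
    (Amx mu a b (diag2_mx lquat_i) (diag2_mx lquat_j) (diag2_mx lquat_k)
       (p *: basis_u R 0)).
Proof.
have [[i0 _ _ _] [j0 _ _ _] [k0 _ _ _]] := @lquat_basis R.
have VE : Vmx (diag2_mx lquat_i) (diag2_mx lquat_j) (diag2_mx lquat_k)
     (p *: basis_u R 0) =
   col_mx (\matrix_(i < 4, j < 3) (p *+ (i == j.+1 :> nat))) (0 : 'M_(4, 3)).
  rewrite -scale_Vmx /Vmx /diag2_mx !diag_block_basis_u // i0 j0 k0.
  apply/matrixP => i j.
  case: (@split_ordP 4 4 i) => i' ->; rewrite mxE.
    rewrite (@col_mxEu _ 4 4 3) [RHS]mxE -mulr_natr.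
    case: (@split_ordP (1 + 1) 1 j) => j' ->;
      rewrite ?(@row_mxEl _ 8 (1 + 1) 1) ?(@row_mxEr _ 8 (1 + 1) 1).
      by case: (@split_ordP 1 1 j') => j'' ->;
        rewrite ?(@row_mxEl _ 8 1 1) ?(@row_mxEr _ 8 1 1) (@col_mxEu _ 4 4 1) mxE
          !ord1 -val_eqE /= inordK // andbT.
    by rewrite (@col_mxEu _ 4 4 1) mxE !ord1 -val_eqE /= inordK // andbT.
  rewrite (@col_mxEd _ 4 4 3) [RHS]mxE.
  case: (@split_ordP (1 + 1) 1 j) => j' ->;
      rewrite ?(@row_mxEl _ 8 (1 + 1) 1) ?(@row_mxEr _ 8 (1 + 1) 1).
    by case: (@split_ordP 1 1 j') => j'' ->;
        rewrite ?(@row_mxEl _ 8 1 1) ?(@row_mxEr _ 8 1 1) (@col_mxEd _ 4 4 1) mxE mulr0.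
  by rewrite (@col_mxEd _ 4 4 1) mxE mulr0.
rewrite /Amx /B2mx VE; apply/matrixP => i j.
case: (@split_ordP 1 11 i) => i1 ->; case: (@split_ordP 1 11 j) => j1 ->.
- by rewrite ord1 mxE (@block_mxEul _ 1 11 1 11) !mxE.
- by rewrite ord1 mxE (@block_mxEur _ 1 11 1 11) !mxE.
- rewrite ord1 (@block_mxEdl _ 1 11 1 11) [RHS]mxE.
  by move: i1 => [[|[|[|[|[|[|[|[|[|[|[|//]]]]]]]]]]] h];
    rewrite !mxE -!val_eqE /= !inordK //= ?mulr0 ?oppr0 ?addr0.
rewrite (@block_mxEdr _ 1 11 1 11).
case: (@split_ordP 3 8 i1) => i2 ->; case: (@split_ordP 3 8 j1) => j2 ->.
- rewrite (@block_mxEul _ 3 8 3 8).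
  case: i2 => [[|[|[|//]]] h]; rewrite !mxE -!val_eqE /= !inordK //=;
  case: j2 => [[|[|[|//]]] h']; rewrite /= ?mulr1 ?mulr0 //.
- rewrite (@block_mxEur _ 3 8 3 8) [RHS]mxE.
  by case: i2 => [[|[|[|//]]] h]; rewrite !mxE -!val_eqE /= !inordK //= mulr0.
- rewrite (@block_mxEdl _ 3 8 3 8).
  case: (@split_ordP 4 4 i2) => i3 ->.
  + rewrite (@col_mxEu _ 4 4 3).
    case: i3 => [[|[|[|[|//]]]] h]; rewrite !mxE -!val_eqE /= !inordK //=;
    case: j2 => [[|[|[|//]]] h']; rewrite /= ?mulr1 ?mulr0 ?subr0 ?addr0 //.
  + rewrite (@col_mxEd _ 4 4 3) [RHS]mxE.
    case: i3 => [[|[|[|[|//]]]] h]; rewrite !mxE -!val_eqE /= !inordK //=;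
    case: j2 => [[|[|[|//]]] h']; rewrite /= ?mulr1 ?mulr0 ?subr0 ?addr0 //.
rewrite (@block_mxEdr _ 3 8 3 8).
case: (@split_ordP 4 4 i2) => i3 ->; case: (@split_ordP 4 4 j2) => j3 ->.
- rewrite (@block_mxEul _ 4 4 4 4).
  case: i3 => [[|[|[|[|//]]]] h]; rewrite !mxE -!val_eqE /= !inordK //=;
  case: j3 => [[|[|[|[|//]]]] h'];
    rewrite /= ?mulr1 ?mulr0 ?subr0 ?add0r ?addr0 ?sub0r //.
- rewrite (@block_mxEur _ 4 4 4 4).
  case: i3 => [[|[|[|[|//]]]] h]; rewrite !mxE -!val_eqE /= !inordK //=;
  case: j3 => [[|[|[|[|//]]]] h']; rewrite /= ?mulr1 ?mulr0 ?subr0 ?add0r ?addr0 //.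
- rewrite (@block_mxEdl _ 4 4 4 4).
  case: i3 => [[|[|[|[|//]]]] h]; rewrite !mxE -!val_eqE /= !inordK //=;
  case: j3 => [[|[|[|[|//]]]] h']; rewrite /= ?mulr1 ?mulr0 ?subr0 ?add0r ?addr0 //.
rewrite (@block_mxEdr _ 4 4 4 4).
  case: i3 => [[|[|[|[|//]]]] h]; rewrite !mxE -!val_eqE /= !inordK //=;
  case: j3 => [[|[|[|[|//]]]] h'];
    rewrite /= ?mulr1 ?mulr0 ?subr0 ?add0r ?addr0 ?sub0r //.
Qed.

Lemma listed_alg_iso l : lie_isomorphic (label_quat_alg l) (listed_alg l).
Proof. by apply: coframe_iso; rewrite formsE coframe_param_forms. Qed.

End Labels.

(** * Invariants *)

(* A real root of the second factor forces b = 0, so if m <> m' both sides are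
   products of powers of x - m and x - m' with exponents 3, 8 and 8, 3. *)
Lemma char_poly_values_inj {R : realFieldType} (m a b m' a' b' : R) :
    (forall x, (x - m) ^+ 3 * ((x - a) ^+ 2 + b ^+ 2) ^+ 4 =
               (x - m') ^+ 3 * ((x - a') ^+ 2 + b' ^+ 2) ^+ 4) ->
  [/\ m = m', a = a' & b ^+ 2 = b' ^+ 2].
Proof.
move=> eqp.
have sum_sqr_eq0 (y z : R) : (y ^+ 2 + z ^+ 2 == 0) = (y == 0) && (z == 0).
  by rewrite paddr_eq0 ?sqr_ge0 // !sqrf_eq0.
have mm' : m = m'.
  apply/eqP/negPn/negP => ne.
  have := eqp m; rewrite subrr expr0n mul0r => /esym/eqP.
  rewrite mulf_eq0 !expf_eq0 subr_eq0 (negPf ne) /= sum_sqr_eq0 subr_eq0.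
  move=> /andP[/eqP ma' /eqP b'0].
  have := eqp m'; rewrite subrr expr0n mul0r => /eqP.
  rewrite mulf_eq0 !expf_eq0 subr_eq0 eq_sym (negPf ne) /= sum_sqr_eq0 subr_eq0.
  move=> /andP[/eqP m'a /eqP b0].
  have := eqp (m *+ 2 - m'); rewrite -ma' -m'a b0 b'0 => /eqP.
  rewrite -subr_eq0.
  have -> : (m *+ 2 - m' - m) ^+ 3 * ((m *+ 2 - m' - m') ^+ 2 + 0 ^+ 2) ^+ 4 -
    (m *+ 2 - m' - m') ^+ 3 * ((m *+ 2 - m' - m) ^+ 2 + 0 ^+ 2) ^+ 4
    = 248%:R * (m - m') ^+ 11 by ring.
  by rewrite mulf_eq0 pnatr_eq0 expf_eq0 subr_eq0 (negPf ne).
rewrite -mm' in eqp *.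
have quad_eq x : x - m != 0 -> (x - a) ^+ 2 + b ^+ 2 = (x - a') ^+ 2 + b' ^+ 2.
  move=> xm; have := eqp x => /(mulfI (expf_neq0 3 xm)) /eqP.
  by rewrite eqrXn2 ?addr_ge0 ?sqr_ge0 // => /eqP.
have h1 : (m + 1) - m != 0 by rewrite addrAC subrr add0r oner_eq0.
have h2 : (m + 2%:R) - m != 0 by rewrite addrAC subrr add0r pnatr_eq0.
have := quad_eq _ h1; have := quad_eq _ h2 => e2 e1.
have aa' : a = a'.
  have : 2%:R * (a' - a) = 0.
    have -> : 2%:R * (a' - a) =
      ((m + 2%:R - a) ^+ 2 + b ^+ 2 - ((m + 2%:R - a') ^+ 2 + b' ^+ 2))
      - ((m + 1 - a) ^+ 2 + b ^+ 2 - ((m + 1 - a') ^+ 2 + b' ^+ 2)) by ring.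
    by rewrite e1 e2 !subrr.
  by move=> /eqP; rewrite mulf_eq0 pnatr_eq0 /= subr_eq0 => /eqP.
by split=> //; move: e1; rewrite aa' => /addrI.
Qed.

Lemma det_Kmx {R : realType} (a b : R) : \det (Kmx a b) = (a ^+ 2 + b ^+ 2) ^+ 2.
Proof.
pose rot (c : R) : 'M[R]_2 :=
  \matrix_(i, j) if i == j then a else if (i < j)%N then - c else c.
have det_rot c : \det (rot c) = a ^+ 2 + c ^+ 2.
  rewrite (expand_det_row _ 0) !big_ord_recl big_ord0 /cofactor !det_mx11 !mxE /=; ring.
have -> : Kmx a b = block_mx (rot b) 0 0 (rot (- b)).
  apply/matrixP => i j.
  case: (@split_ordP 2 2 i) => i' ->; case: (@split_ordP 2 2 j) => j' ->.
  - rewrite (@block_mxEul _ 2 2 2 2) !mxE.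
    by case: i' => [[|[|//]] h]; case: j' => [[|[|//]] h'].
  - rewrite (@block_mxEur _ 2 2 2 2) !mxE.
    by case: i' => [[|[|//]] h]; case: j' => [[|[|//]] h'].
  - rewrite (@block_mxEdl _ 2 2 2 2) !mxE.
    by case: i' => [[|[|//]] h]; case: j' => [[|[|//]] h'].
  - rewrite (@block_mxEdr _ 2 2 2 2) !mxE.
    by case: i' => [[|[|//]] h]; case: j' => [[|[|//]] h']; rewrite //= opprK.
by rewrite (@det_ublock _ 2 2) !det_rot sqrrN expr2.
Qed.

Lemma det_sub_Amx {R : realType} (x mu a b : R) J1 J2 J3 v :
  \det (x%:M - Amx mu a b J1 J2 J3 v) =
  (x - mu) ^+ 3 * ((x - a) ^+ 2 + b ^+ 2) ^+ 4.
Proof.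
rewrite /Amx (@scalar_mx_block _ 3 8) (@opp_block_mx _ 3 8 3 8).
rewrite (@add_block_mx _ 3 8 3 8) subr0 add0r (@det_lblock _ 3 8).
rewrite -raddfB /= det_scalar; congr (_ * _).
rewrite /B2mx (@scalar_mx_block _ 4 4) (@opp_block_mx _ 4 4 4 4).
rewrite (@add_block_mx _ 4 4 4 4) subr0 (@det_lblock _ 4 4).
have -> : x%:M - Kmx a b = Kmx (x - a) (- b).
  by rewrite !Kmx_rquat -rquat_mx_scalar; mx4_ring.
by rewrite det_Kmx sqrrN -exprD.
Qed.

Section Classification.
Context {R : realType}.
Implicit Types (l : label R) (mu a b k p : R).

Lemma Amx_sim_params k mu a b mu' a' b' (J1 J2 J3 : 'M[R]_8) v v' (P : 'M_11) :
    k != 0 -> P \in unitmx ->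
    P *m Amx mu a b J1 J2 J3 v = k *: (Amx mu' a' b' J1 J2 J3 v' *m P) ->
  [/\ mu = k * mu', a = k * a' & b ^+ 2 = (k * b') ^+ 2].
Proof.
move=> k0 Pu PA; apply: char_poly_values_inj => x.
rewrite -(det_sub_Amx x mu a b J1 J2 J3 v).
have -> : (x - k * mu') ^+ 3 * ((x - k * a') ^+ 2 + (k * b') ^+ 2) ^+ 4 =
    k ^+ 11 * ((x / k - mu') ^+ 3 * ((x / k - a') ^+ 2 + b' ^+ 2) ^+ 4).
  by field.
rewrite -(det_sub_Amx (x / k) mu' a' b' J1 J2 J3 v') -detZ.
have Pdet : \det P != 0 by rewrite -unitfE -unitmxE.
apply: (mulfI Pdet); rewrite -det_mulmx [RHS]mulrC -det_mulmx; congr determinant.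
rewrite mulmxBr PA -scalemxAl mulmxBl scalerBr mul_mx_scalar mul_scalar_mx.
by rewrite scalerA mulrC divfK.
Qed.

Lemma nilp_Amx_sqr mu p :
  let N := Amx mu mu 0 (diag2_mx lquat_i) (diag2_mx lquat_j) (diag2_mx lquat_k)
             (p *: basis_u R 0) - mu%:M in
  (N *m N == 0) = (p == 0).
Proof.
move=> N; have B0_comm := @B2mx_comm R 0 0.
have BE : B2mx mu 0 - mu%:M = B2mx 0 0.
  rewrite /B2mx (@scalar_mx_block _ 4 4) (@opp_block_mx _ 4 4 4 4).
  rewrite [LHS](@add_block_mx _ 4 4 4 4) !subr0 !Kmx_rquat !rquat_mx_scalar subrr.
  by rewrite raddf0.
have NE : N = @block_mx R 3 8 3 8 0 0 (Vmx (diag2_mx lquat_i) (diag2_mx lquat_j)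
    (diag2_mx lquat_k) (p *: basis_u R 0)) (B2mx 0 0).
  rewrite /N /Amx (@scalar_mx_block _ 3 8) (@opp_block_mx _ 3 8 3 8).
  by rewrite (@add_block_mx _ 3 8 3 8) BE !subrr subr0.
have B0u : B2mx 0 0 *m basis_u R 0 = basis_w R 0.
  rewrite basis_uE // basis_wE // [LHS](@mul_block_col R 4 4 4 4 1).
  by rewrite Kmx_rquat rquat_mx_scalar raddf0 !mul0mx !mul1mx !addr0.
have B00 : B2mx (0 : R) 0 *m B2mx 0 0 = 0.
  rewrite [LHS](@mulmx_block R 4 4 4 4 4 4) !Kmx_rquat rquat_mx_scalar raddf0.
  by rewrite !mul0mx !mulmx0 !addr0 block_mx0.
rewrite NE (@mulmx_block R 3 8 3 8 3 8) B00 !mul0mx !mulmx0 !addr0 add0r.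
rewrite (mul_Vmx_comm _ B0_comm) -scalemxAr B0u.
apply/eqP/eqP => [|->]; last first.
  by rewrite -scale_Vmx scale0r block_mx0.
move=> /(congr1 (@dlsubmx R 3 8 3 8)); rewrite block_mxKdl.
rewrite -(@block_mx0 R 3 8 3 8) block_mxKdl => V0.
have := congr1 (fun V : 'M_(8, 1 + 1 + 1) => lsubmx (lsubmx V)) V0.
rewrite /Vmx !row_mxKl !linear0 => J1w.
have [[h0 _ _ _] _ _] := @lquat_basis R.
have := J1w; rewrite -scalemxAr diag_block_basis_w // h0 => /eqP.
rewrite scaler_eq0 => /orP[/eqP //|/eqP].
rewrite -(@col_mx0 R 4 4 1) => /(congr1 (@dsubmx R 4 4 1)).
rewrite !col_mxKd => /matrixP /(_ (inord 1) 0) /eqP.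
by rewrite !mxE !eqxx oner_eq0.
Qed.

Lemma label_quat_alg_inj l l' : admissible l -> admissible l' ->
  lie_isomorphic (label_quat_alg l) (label_quat_alg l') -> l = l'.
Proof.
move=> al al' iso.
have [k [P [k0 Pu PA]]] := almost_abelian_iso_inv _ _ _ _ (Amx_rank _ _ _ _ _ _ _) iso.
have [e1 e2 e3] := Amx_sim_params _ _ _ _ _ _ _ _ _ _ _ _ _ k0 Pu PA.
have ep : label_mu l = label_a l -> label_b l = 0 ->
    label_mu l' = label_a l' -> label_b l' = 0 ->
    (label_p l == 0) = (label_p l' == 0).
  move=> ma b0 ma' b0'; move: PA; rewrite -ma b0 -ma' b0' => PA.
  rewrite -(nilp_Amx_sqr (label_mu l)) -(nilp_Amx_sqr (label_mu l')).
  set N := _ - _; set N' := _ - _.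
  have PN : P *m N = k *: (N' *m P).
    rewrite /N /N' mulmxBr mulmxBl PA scalerBr mul_mx_scalar mul_scalar_mx.
    by rewrite scalerA -e1.
  have PNN : P *m (N *m N) = k ^+ 2 *: (N' *m N' *m P).
    by rewrite mulmxA PN -scalemxAl -[_ *m P *m N]mulmxA PN -scalemxAr scalerA mulmxA.
  apply/eqP/eqP => NN0.
    move: PNN; rewrite NN0 mulmx0 => /esym/eqP.
    rewrite scaler_eq0 expf_eq0 (negPf k0) /= => /eqP /(congr1 (mulmx^~ (invmx P))).
    by rewrite mulmxK // mul0mx.
  by move: PNN; rewrite NN0 mul0mx scaler0 => /(congr1 (mulmx (invmx P)));
    rewrite mulKmx // mulmx0.
have kk : k <> 0 by apply/eqP.
move: al al' e1 e2 e3 ep {iso PA}.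
case: l => [a|a b||s|a|]; case: l' => [a'|a' b'||s'|a'|];
  rewrite /= => al al' e1 e2 e3 ep //;
  try by exfalso; apply: kk; first [lra | nra].
- congr S13; apply/eqP; rewrite -(@eqrXn2 _ 2) //; apply/eqP.
  by move: e3; rewrite mulr1 expr1n => k2; rewrite e2 exprMn -k2 mul1r.
- have k1 : k = 1 by rewrite e1 mulr1.
  rewrite {}k1 !mul1r in e2 e3; congr S14 => //.
  by apply/eqP; rewrite -(@eqrXn2 _ 2) ?ltW //; apply/eqP.
- have := ep erefl erefl erefl erefl.
  by case: al => ->; case: al' => -> //; rewrite eqxx oner_eq0.
- by congr S17; rewrite e2; move: e1; rewrite mulr1 => <-; rewrite mul1r.
Qed.

Lemma label_quat_alg_p0 l :
  label_p l = 0 -> label_quat_alg l = quat_alg (label_mu l) (label_a l) (label_b l) 0.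
Proof. by rewrite /label_quat_alg => ->; rewrite scale0r. Qed.

Lemma label_quat_alg_p1 l :
  label_p l = 1 ->
  label_quat_alg l = quat_alg (label_mu l) (label_a l) (label_b l) (basis_u R 0).
Proof. by rewrite /label_quat_alg => ->; rewrite scale1r. Qed.

Lemma label_of_scaling mu a b k l : k != 0 ->
    label_p l = 0 -> label_mu l = k * mu -> label_a l = k * a -> label_b l = `|k * b| ->
  lie_isomorphic (quat_alg mu a b 0) (label_quat_alg l).
Proof.
by move=> k0 /label_quat_alg_p0 -> -> -> ->; apply: quat_alg_scale_abs.
Qed.

Lemma label_quat_alg_exists mu a b (v : 'cV[R]_8) : 0 <= b ->
  exists l, admissible l /\ lie_isomorphic (quat_alg mu a b v) (label_quat_alg l).
Proof.
move=> b0.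
have [ne|/norP[]] := boolP ((mu != a) || (b != 0)); last first.
  rewrite !negbK => /eqP <- /eqP ->.
  have red := quat_alg_kill_w mu v.
  have [p0|p0] := eqVneq (usubmx (v : 'cV_(4 + 4))) 0.
    rewrite p0 col_mx0 in red.
    have [mu0|mu0] := eqVneq mu 0.
      exists (S16 0); split; first by left.
      apply: (lie_isomorphic_trans red).
      apply: (label_of_scaling _ _ _ 1) => //=; first exact: oner_neq0.
      - by rewrite mu0 mulr0.
      - by rewrite mu0 mulr0.
      - by rewrite mulr0 normr0.
    exists (S17 1); split; first by [].
    apply: (lie_isomorphic_trans red).
    apply: (label_of_scaling _ _ _ mu^-1); rewrite /= ?mulVf //.
    - by rewrite invr_eq0.
    - by rewrite mulr0 normr0.
  have [mu0|mu0] := eqVneq mu 0.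
    exists (S16 1); split; first by right.
    rewrite label_quat_alg_p1; last by [].
    apply: (lie_isomorphic_trans red).
    have := quat_alg_unit 1 mu mu _ (oner_neq0 _) p0.
    by rewrite mu0 mulr0.
  exists (S18 R); split; first by [].
  rewrite label_quat_alg_p1; last by [].
  apply: (lie_isomorphic_trans red).
  have := quat_alg_unit mu^-1 mu mu _ (invr_neq0 mu0) p0.
  by rewrite mulVf.
have red := quat_alg_kill mu a b v ne.
have [mu0|mu0] := eqVneq mu 0; have [b_0|b_neq0] := eqVneq b 0.
- have a0 : a != 0 by move: ne; rewrite mu0 b_0 eqxx orbF eq_sym.
  exists (S15 R); split; first by [].
  apply: (lie_isomorphic_trans red).
  apply: (label_of_scaling _ _ _ a^-1); rewrite /= ?mulVf ?invr_eq0 //.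
  + by rewrite mu0 mulr0.
  + by rewrite b_0 mulr0 normr0.
- have b_gt0 : 0 < b by rewrite lt_def b_neq0.
  exists (S13 (`|a| / b)); split; first by rewrite /= divr_ge0.
  apply: (lie_isomorphic_trans red).
  apply: (label_of_scaling _ _ _ ((-1) ^+ (a < 0)%R / b)); rewrite //=.
  + by rewrite mulf_neq0 ?signr_eq0 ?invr_eq0.
  + by rewrite mu0 mulr0.
  + by rewrite [RHS]mulrAC; congr (_ / _); rewrite normrEsign.
  + by rewrite mulfVK // normr_sign.
- exists (S17 (a / mu)); split; first by [].
  apply: (lie_isomorphic_trans red).
  apply: (label_of_scaling _ _ _ mu^-1); rewrite /= ?mulVf ?invr_eq0 //.
  + exact: mulrC.
  + by rewrite b_0 mulr0 normr0.
- exists (S14 (a / mu) `|mu^-1 * b|); split.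
    by rewrite /= normr_gt0 mulf_neq0 ?invr_eq0.
  apply: (lie_isomorphic_trans red).
  apply: (label_of_scaling _ _ _ mu^-1); rewrite /= ?mulVf ?invr_eq0 //.
  exact: mulrC.
Qed.

End Classification.

Theorem theorem5p3 (R : realType) (mu a1 b1 : R) (hb1 : 0 <= b1)
    (J1 J2 J3 : 'M[R]_8) (hJ : hypercomplex_on_basis J1 J2 J3)
    (hB : [/\ B2mx a1 b1 *m J1 = J1 *m B2mx a1 b1,
              B2mx a1 b1 *m J2 = J2 *m B2mx a1 b1 &
              B2mx a1 b1 *m J3 = J3 *m B2mx a1 b1])
    (v0 : 'cV[R]_8) :
  exists! l : label R,
    admissible l /\
    lie_isomorphic (almost_abelian (Amx mu a1 b1 J1 J2 J3 v0)) (listed_alg l).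
Proof.
have [J1E J2E J3E] := hypercomplex_block hJ; rewrite {}J1E {}J2E {}J3E.
have [l [al iso_l]] := label_quat_alg_exists mu a1 b1 v0 hb1.
exists l; split.
  by split; last exact: lie_isomorphic_trans iso_l (listed_alg_iso l).
move=> l' [al' iso_l']; apply: (label_quat_alg_inj _ _ al al').
apply: (lie_isomorphic_trans (lie_isomorphic_sym iso_l)).
exact: lie_isomorphic_trans iso_l' (lie_isomorphic_sym (listed_alg_iso l')).
Qed.
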